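(* Let $(X,\varphi)$ be a Cantor minimal system and let $(Z,\eta)$ be an odometer. Then there is at most one factor map (up to conjugacy) from $(X,\varphi)$ to $(Z,\eta)$; that is, if $\beta_1,\beta_2:(X,\varphi)\to(Z,\eta)$ are factor maps then there is a conjugacy $\gamma:(Z,\eta)\to(Z,\eta)$ such that $\beta_1=\gamma\circ\beta_2$.
   Context: A Cantor minimal system $(X,\varphi)$ is a minimal homeomorphism $\varphi$ of a space $X$ homeomorphic to the Cantor set. A factor map $(X,\varphi)\to(Y,\psi)$ is a continuous surjection $\alpha:X\to Y$ with $\alpha\circ\varphi=\psi\circ\alpha$; a conjugacy is a factor map that is a homeomorphism. For a sequence $(k_n)_{n\ge1}$ of positive integers, an odometer of type $(k_n)_{n\ge1}$ is the minimal system $(X,\varphi)$ with $X=\prod_{n=1}^\infty\{0,1,\ldots,k_n-1\}$ and $\varphi$ the addition of $(1,0,0,\ldots)$ with carrying (to the right). Trivial odometers, with $X$ finite (i.e. $k_n=1$ for all but finitely many $n$), are included. *)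

(* Defs.v *)
From HB Require Import structures.
From mathcomp Require Import all_boot all_classical.
From mathcomp Require Import topology cantor.

Set Implicit Arguments.
Unset Strict Implicit.
Unset Printing Implicit Defensive.

Local Open Scope classical_set_scope.

Definition homeomorphism (X Y : topologicalType) (f : X -> Y) : Prop :=
  exists g : Y -> X,
    [/\ cancel f g, cancel g f, continuous f & continuous g].

(* Invariance is two-sided: phi maps A onto A. *)
Definition minimal (X : topologicalType) (phi : X -> X) : Prop :=
  forall A : set X, closed A -> phi @` A = A -> A = set0 \/ A = [set: X].

Definition cantor_minimal_system (X : topologicalType) (phi : X -> X) : Prop :=
  [/\ exists h : X -> cantor_space, homeomorphism h,
      homeomorphism phi &
      minimal phi].

Definition factor_map (X Y : topologicalType) (phi : X -> X) (psi : Y -> Y)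
    (alpha : X -> Y) : Prop :=
  [/\ continuous alpha,
      set_surj [set: X] [set: Y] alpha &
      alpha \o phi = psi \o alpha].

Definition conjugacy (X Y : topologicalType) (phi : X -> X) (psi : Y -> Y)
    (alpha : X -> Y) : Prop :=
  factor_map phi psi alpha /\ homeomorphism alpha.

(* The digits are numbered from 0: [k n] is the size of the (n+1)-st digit set.
   The product is empty as soon as some [k n] is 0, so positivity of [k] has to
   be assumed separately. *)
Definition odometer_space (k : nat -> nat) : Type :=
  prod_topology (fun n : nat => discrete_topology 'I_(k n)).

HB.instance Definition _ (k : nat -> nat) := Nbhs.on (odometer_space k).
HB.instance Definition _ (k : nat -> nat) := Topological.on (odometer_space k).

(* When 1 is added to digit 0, a carry reaches digit n iff every earlier digit
   is maximal. *)
Fixpoint odometer_carry (k : nat -> nat) (x : odometer_space k) (n : nat) :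
    bool :=
  if n is m.+1 then odometer_carry x m && ((x m : 'I_(k m)).+1 == k m)
  else true.

(* [ordS] is the successor modulo [k n] on ['I_(k n)]. *)
Definition odometer_map (k : nat -> nat) (x : odometer_space k) :
    odometer_space k :=
  fun n => if odometer_carry x n then ordS (x n) else x n.

(* Main.v *)
Require Import Defs.
From HB Require Import structures.
From mathcomp Require Import all_boot all_classical.
From mathcomp Require Import topology cantor.
From mathcomp Require Import zify.

Set Implicit Arguments.
Unset Strict Implicit.
Unset Printing Implicit Defensive.

Local Open Scope classical_set_scope.

(** For every [n], reading the first [n] digits in mixed radix gives a map
    [prefix_value n] from the odometer to the integers modulo
    [radix k n = k_0 ... k_(n-1)], and it turns the odometer map into the
    rotation by 1 ([prefix_value_odometer_map_mod]).  Hence, for two factor maps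
    [beta1] and [beta2], the difference
    [prefix_value n (beta1 x) - prefix_value n (beta2 x)] modulo [radix k n] is
    a locally constant function of [x] that is invariant under [phi]; its level
    sets are closed and invariant, so minimality makes it constant.  The first
    [n] digits of [beta2 x] therefore determine those of [beta1 x], for every
    [n] ([prefix_value_factor]).

    Since [beta2] is onto, [beta1] then factors through [beta2] by a continuous
    map [gamma] ([factor_through]).  The situation is symmetric in [beta1] and
    [beta2], so [beta2] also factors through [beta1], and the two maps obtained
    are inverse to each other because both factor maps are onto.  That [gamma]
    commutes with the odometer map can be checked on points of the form
    [beta2 x], where it follows from the equivariance of the two factor maps. *)

Section PrefixValue.

Context {k : nat -> nat}.
Implicit Types (x y : odometer_space k) (n : nat).

Definition digit x n : nat := (x n : 'I_(k n)).

Fixpoint radix (k : nat -> nat) n : nat :=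
  if n is m.+1 then radix k m * k m else 1.

Fixpoint prefix_value n x : nat :=
  if n is m.+1 then prefix_value m x + radix k m * digit x m else 0.

Lemma prefix_value_lt n x : prefix_value n x < radix k n.
Proof.
elim: n => [|n IHn] //=.
by have := ltn_ord (x n : 'I_(k n)); rewrite -/(digit x n); nia.
Qed.

(** The carry out of the first [n] digits is what the prefix value loses when
    it wraps around, so keeping it in the formula makes the induction exact. *)
Lemma prefix_value_odometer_map n x :
  prefix_value n (odometer_map x) + radix k n * odometer_carry x n
  = (prefix_value n x).+1.
Proof.
elim: n => [|n IHn] //=.
have lt_xn := ltn_ord (x n : 'I_(k n)).
rewrite /digit {2}/odometer_map.
case: (odometer_carry x n) IHn => /= IHn; last first.
  by nia.
have [eq_xn|ne_xn] := eqVneq (x n : 'I_(k n)).+1 (k n).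
  by rewrite eq_xn modnn; nia.
by rewrite modn_small; nia.
Qed.

Lemma prefix_value_odometer_map_mod n x :
  prefix_value n (odometer_map x) = (prefix_value n x).+1 %[mod radix k n].
Proof. by rewrite -prefix_value_odometer_map addnC mulnC modnMDl. Qed.

Lemma prefix_valueS_inj n x y :
  prefix_value n.+1 x = prefix_value n.+1 y -> x n = y n.
Proof.
move=> /= eq_xy; apply: val_inj; rewrite /= -!/(digit _ _).
have lt_x := prefix_value_lt n x; have lt_y := prefix_value_lt n y.
have r0 : 0 < radix k n by exact: leq_ltn_trans lt_x.
have := congr1 (divn^~ (radix k n)) eq_xy.
rewrite !(addnC (prefix_value n _)) !(mulnC (radix k n)) !divnMDl //.
by rewrite !divn_small // !addn0.
Qed.

(** Prefix values are locally constant, since each depends on finitely many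
    discrete coordinates.  With [continuous_odometer] this replaces the product
    topology by statements about prefix values. *)
Lemma nbhs_prefix_value n x :
  nbhs x [set y | prefix_value n y = prefix_value n x].
Proof.
elim: n => [|n IHn] /=; first by apply: filterS filterT.
have nbhs_xn : nbhs x [set y | y n = x n].
  exact: (@proj_continuous nat (fun n => discrete_topology 'I_(k n)) n x
            _ (discrete_set1 (x n))).
by apply: filterS2 IHn nbhs_xn => y /= -> eq_yn; rewrite /digit eq_yn.
Qed.

Lemma continuous_odometer (Y : topologicalType) (f : Y -> odometer_space k) :
  (forall n (y : Y), nbhs y [set z | prefix_value n (f z) = prefix_value n (f y)]) ->
  continuous f.
Proof.
move=> loc_f y; apply/cvg_sup => n U [V] [[W] oW <-] Wfy WU.
apply: filterS WU _; apply: filterS (loc_f n.+1 y) => z /prefix_valueS_inj eq_zy.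
by rewrite /= eq_zy.
Qed.

End PrefixValue.

Section Factors.

Context {X : topologicalType} {phi : X -> X} {k : nat -> nat}.
Implicit Types (n : nat) (beta : X -> odometer_space k).

Lemma factor_map_prefix_value n beta x : factor_map phi (@odometer_map k) beta ->
  prefix_value n (beta (phi x)) = (prefix_value n (beta x)).+1 %[mod radix k n].
Proof.
by case=> _ _ /(congr1 (@^~ x)) /= ->; exact: prefix_value_odometer_map_mod.
Qed.

Lemma nbhs_prefix_value_factor n beta x : continuous beta ->
  nbhs x [set y | prefix_value n (beta y) = prefix_value n (beta x)].
Proof. by move=> cb; exact: (cb x _ (nbhs_prefix_value n (beta x))). Qed.

(** Minimality asks for [phi @` P = P]: invariance read forwards gives one
    inclusion, and read backwards, together with surjectivity of [phi], the
    other. *)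
Lemma minimal_invariant (P : set X) :
  homeomorphism phi -> minimal phi -> closed P ->
  (forall x, P (phi x) <-> P x) -> P !=set0 -> forall x, P x.
Proof.
move=> [psi [_ psiK _ _]] min_phi closed_P invP [x0 Px0] x.
have phiP : phi @` P = P.
  apply/seteqP; split => [_ [y Py <-]|y Py]; first exact/invP.
  by exists (psi y); rewrite ?psiK //; apply/invP; rewrite psiK.
have [P0|->] := min_phi P closed_P phiP; last by [].
by rewrite P0 in Px0.
Qed.

(** The set of points where the two prefix values differ by the same amount as
    at [x], modulo [radix k n], is closed, invariant and contains [x]; by
    minimality it also contains [y]. *)
Lemma prefix_value_factor beta1 beta2 n x y :
  homeomorphism phi -> minimal phi ->
  factor_map phi (@odometer_map k) beta1 ->
  factor_map phi (@odometer_map k) beta2 ->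
  prefix_value n (beta2 x) = prefix_value n (beta2 y) ->
  prefix_value n (beta1 x) = prefix_value n (beta1 y).
Proof.
move=> homeo_phi min_phi fac1 fac2 eq2.
have [[cts1 _ _] [cts2 _ _]] := (fac1, fac2).
(* [c] represents the difference of the two prefix values at [x]; adding
   [radix k n] keeps the subtraction in [nat] from being truncated. *)
pose c := prefix_value n (beta1 x) + (radix k n - prefix_value n (beta2 x)).
pose P := [set z | prefix_value n (beta1 z)
                   = prefix_value n (beta2 z) + c %[mod radix k n]].
have lt1 z := prefix_value_lt n (beta1 z).
have lt2 z := prefix_value_lt n (beta2 z).
have Px : P x.
  rewrite /P /= /c addnCA subnKC; last exact: ltnW.
  by rewrite modnDr.
have closed_P : closed P.
  rewrite -(setCK P); apply: open_closedC; rewrite openE => z nPz.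
  apply: filterS2 (nbhs_prefix_value_factor n z cts1)
                  (nbhs_prefix_value_factor n z cts2) => w /= eq1w eq2w.
  by rewrite /P /= eq1w eq2w.
have invP z : P (phi z) <-> P z.
  rewrite /P /= (factor_map_prefix_value n z fac1) -modnDml.
  rewrite (factor_map_prefix_value n z fac2) modnDml addSn.
  rewrite -addn1 -[in X in _ = X]addn1.
  by split=> /eqP; [|move=> eqz; apply/eqP]; rewrite eqn_modDr // => /eqP.
have Py : P y.
  by apply: (minimal_invariant homeo_phi min_phi closed_P invP); exists x.
by rewrite -(modn_small (lt1 x)) Px eq2 -Py modn_small.
Qed.

(** [gamma] is [beta1] applied to an arbitrary point of the fibre of [beta2]. The
    hypothesis on prefix values makes the choice of that point irrelevant, and
    it bounds the modulus of continuity of [gamma]: the first [n] digits of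
    [gamma z] depend only on the first [n] digits of [z]. *)
Lemma factor_through beta1 beta2 : set_surj [set: X] [set: odometer_space k] beta2 ->
  (forall n x y, prefix_value n (beta2 x) = prefix_value n (beta2 y) ->
                 prefix_value n (beta1 x) = prefix_value n (beta1 y)) ->
  exists2 gamma : odometer_space k -> odometer_space k,
    continuous gamma & forall x, gamma (beta2 x) = beta1 x.
Proof.
move=> surj2 fib.
have /choice[s sK] : forall z, exists x, beta2 x = z.
  by move=> z; have [x _ <-] := surj2 z I; exists x.
exists (beta1 \o s) => [|x].
  apply: continuous_odometer => n z.
  by apply: filterS (nbhs_prefix_value n z) => w /= eq_wz; apply: fib; rewrite !sK.
apply: functional_extensionality_dep => n.
by apply: prefix_valueS_inj; apply: fib; rewrite sK.
Qed.

End Factors.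

Theorem proposition4p14 (X : topologicalType) (phi : X -> X)
    (k : nat -> nat) (beta1 beta2 : X -> odometer_space k) :
  cantor_minimal_system phi ->
  (forall n : nat, 0 < k n) ->
  factor_map phi (@odometer_map k) beta1 ->
  factor_map phi (@odometer_map k) beta2 ->
  exists gamma : odometer_space k -> odometer_space k,
    conjugacy (@odometer_map k) (@odometer_map k) gamma /\
    beta1 = gamma \o beta2.
Proof.
move=> [_ homeo_phi min_phi] _ fac1 fac2.
have [[_ surj1 eqv1] [_ surj2 eqv2]] := (fac1, fac2).
have [gamma cts_gamma gammaE] := factor_through surj2
  (fun n x y => prefix_value_factor homeo_phi min_phi fac1 fac2).
have [delta cts_delta deltaE] := factor_through surj1
  (fun n x y => prefix_value_factor homeo_phi min_phi fac2 fac1).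
have gammaK : cancel gamma delta.
  by move=> z; have [x _ <-] := surj2 z I; rewrite gammaE deltaE.
have deltaK : cancel delta gamma.
  by move=> z; have [x _ <-] := surj1 z I; rewrite deltaE gammaE.
exists gamma; split; last by apply/funext => x /=; rewrite gammaE.
split; last by exists delta.
split=> // [z _|]; first by exists (delta z).
apply/funext => z /=; have [x _ <-] := surj2 z I.
have := congr1 (@^~ x) eqv2; have := congr1 (@^~ x) eqv1 => /= eq1 <-.
by rewrite !gammaE.
Qed.
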